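(* There exist a totally disconnected compact metrizable abelian group $X$ and a countable amenable subgroup $\Gamma \subset \mathrm{Aut}(X)$ of the group of continuous group automorphisms of $X$ such that the natural action $\Gamma \curvearrowright X$ is expansive, has positive topological entropy, and has no off-diagonal asymptotic pairs. In particular, the group $\Gamma$ can be taken to be abelian, for instance $\Gamma \cong \bigoplus_{n\in\mathbb{Z}} (\mathbb{Z}/2\mathbb{Z})$.
   Context: Let $\Gamma$ be a countable group acting by homeomorphisms on a compact metrizable space $X$ with compatible metric $d$. The action is expansive if there is $c>0$ such that for all $x\ne y$ in $X$ there is $g\in\Gamma$ with $d(g\cdot x,g\cdot y)>c$. A pair $(x,y)\in X\times X$ is asymptotic if for every $\epsilon>0$ there are at most finitely many $g\in\Gamma$ with $d(g\cdot x,g\cdot y)>\epsilon$; it is off-diagonal if $x\ne y$. Topological entropy is the usual topological entropy of a continuous action of a countable amenable group on a compact metrizable space. *)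

(* Defs.v *)
From HB Require Import structures.
From mathcomp Require Import all_boot all_order all_algebra finmap.
From mathcomp Require Import all_classical all_reals all_analysis.

Set Implicit Arguments.
Unset Strict Implicit.
Unset Printing Implicit Defensive.

Import Order.TTheory GRing.Theory Num.Theory.
Import numFieldNormedType.Exports.

Local Open Scope classical_set_scope.
Local Open Scope ring_scope.

Section ContinuousAutomorphisms.
Context {X : topologicalZmodType}.

Definition is_automorphism (f : X -> X) : Prop :=
  [/\ {morph f : x y / x + y},
      continuous f
    & exists g : X -> X, [/\ continuous g, cancel f g & cancel g f]].

Lemma is_automorphism_id : is_automorphism id.
Proof.
have id_cont : continuous (@id X) by move=> x; exact: cvg_id.
by split=> //; exists id; split.
Qed.

Lemma is_automorphism_comp (f g : X -> X) :
  is_automorphism f -> is_automorphism g -> is_automorphism (f \o g).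
Proof.
move=> [fD fc [f' [f'c fK f'K]]] [gD gc [g' [g'c gK g'K]]]; split.
- by move=> x y /=; rewrite gD fD.
- by move=> x; apply: continuous_comp; [exact: gc | exact: fc].
- exists (g' \o f'); split; [|exact: can_comp|exact: can_comp].
  by move=> x; apply: continuous_comp; [exact: f'c | exact: g'c].
Qed.

Lemma is_automorphism_inv (f : X -> X) : is_automorphism f ->
  {g : X -> X | [/\ is_automorphism g, cancel f g & cancel g f]}.
Proof.
move=> [fD fc /cid[g [gc fK gK]]]; exists g; split=> //; split=> //.
  by move=> x y; apply: (can_inj fK); rewrite fD !gK.
by exists f.
Qed.

End ContinuousAutomorphisms.

Record Aut (X : topologicalZmodType) := MkAut {
  aut_fun :> X -> X;
  aut_funP : is_automorphism aut_fun }.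

Section AutGroup.
Context {X : topologicalZmodType}.
Implicit Types a b : Aut X.

Lemma autP a b : a =1 b -> a = b.
Proof.
case: a b => [f Pf] [g Pg] /= /funext fg.
by case: g / fg in Pg *; congr MkAut; exact: Prop_irrelevance.
Qed.

Definition aut_one : Aut X := MkAut is_automorphism_id.

Definition aut_mul a b : Aut X :=
  MkAut (is_automorphism_comp (aut_funP a) (aut_funP b)).

Definition aut_inv a : Aut X :=
  let: exist _ Pg := is_automorphism_inv (aut_funP a) in
  let: And3 g_aut _ _ := Pg in MkAut g_aut.

HB.instance Definition _ := gen_eqMixin (Aut X).
HB.instance Definition _ := gen_choiceMixin (Aut X).

Lemma aut_mulA : associative aut_mul. Proof. by move=> *; exact: autP. Qed.
Lemma aut_mul1 : left_id aut_one aut_mul. Proof. by move=> *; exact: autP. Qed.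
Lemma aut_mulr1 : right_id aut_one aut_mul. Proof. by move=> *; exact: autP. Qed.

Lemma aut_mulV : left_inverse aut_one aut_inv aut_mul.
Proof.
move=> a; apply: autP => x; rewrite /aut_inv /=.
by case: is_automorphism_inv => g [gP aK gK] /=; exact: aK.
Qed.

Lemma aut_mulrV : right_inverse aut_one aut_inv aut_mul.
Proof.
move=> a; apply: autP => x; rewrite /aut_inv /=.
by case: is_automorphism_inv => g [gP aK gK] /=; exact: gK.
Qed.

HB.instance Definition _ :=
  isGroup.Build (Aut X) aut_mulA aut_mul1 aut_mulr1 aut_mulV aut_mulrV.

End AutGroup.

(* Left Folner sequences of a countable subgroup [Gam] of [G]: nonempty finite
   subsets with |g F_n /_\ F_n| / |F_n| --> 0 for every g in [Gam]. *)
Definition folner_sequence (R : realType) {G : groupType} (Gam : set G)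
    (F : nat -> {fset G}) : Prop :=
  [/\ forall n, F n != fset0,
      forall n, [set` F n] `<=` Gam
    & forall g, Gam g ->
        (fun n => let gF := [fset (g * h)%g | h in F n]%fset in
           #|` ((gF `\` F n) `|` (F n `\` gF))%fset|%:R / #|` F n|%:R : R)
          @ \oo --> (0 : R)].

Definition amenable (R : realType) {G : groupType} (Gam : set G) : Prop :=
  exists F : nat -> {fset G}, folner_sequence R Gam F.

Section Entropy.
Context (R : realType) {X : topologicalType} {G : choiceType}.
Variable act : G -> X -> X.

Definition finite_open_cover (U : set (set X)) : Prop :=
  [/\ finite_set U, U `<=` open & \bigcup_(A in U) A = [set: X]].

(* The join over g in F of the covers g^-1 U; its members are the sets
   \bigcap_(g in F) g^-1 (A g) for a choice of A g in U. *)
Definition joined_cover (U : set (set X)) (F : {fset G}) : set (set X) :=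
  [set \bigcap_(g in [set` F]) (act g @^-1` A g)
     | A in [set A : G -> set X | forall g, g \in F -> U (A g)]].

(* The least cardinality of a subcover (attained by well-ordering of nat
   whenever U has a finite subcover). *)
Definition cover_number (U : set (set X)) : R :=
  inf [set #|` V|%:R | V in [set V : {fset set X} |
         [set` V] `<=` U /\ \bigcup_(A in [set` V]) A = [set: X]]].

(* When F is a Folner sequence the limsup is a limit, which does not depend on
   F (Ornstein-Weiss). *)
Definition cover_entropy (F : nat -> {fset G}) (U : set (set X)) : \bar R :=
  limn_esup (fun n =>
    (ln (cover_number (joined_cover U (F n))) / #|` F n|%:R)%:E).

Definition topological_entropy (F : nat -> {fset G}) : \bar R :=
  ereal_sup [set cover_entropy F U | U in finite_open_cover].

End Entropy.

Definition compatible_metric (R : realType) {X : topologicalType}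
    (d : X -> X -> R) : Prop :=
  [/\ forall x y, d x y = 0 <-> x = y,
      forall x y, d x y = d y x,
      forall x y z, d x z <= d x y + d y z
    & forall (x : X) (A : set X), nbhs x A <->
        exists2 e : R, 0 < e & [set y | d x y < e] `<=` A].

Section MetricDynamics.
Context {R : realType} {X G : Type}.
Variables (d : X -> X -> R) (act : G -> X -> X) (Gam : set G).

Definition expansive : Prop :=
  exists2 c : R, 0 < c & forall x y : X, x <> y ->
    exists2 g, Gam g & c < d (act g x) (act g y).

Definition asymptotic_pair (x y : X) : Prop :=
  forall eps : R, 0 < eps ->
    finite_set [set g | Gam g /\ eps < d (act g x) (act g y)].

End MetricDynamics.

(* The direct sum of copies of Z/2Z indexed by the integers: finitely
   supported functions under pointwise addition. *)
Definition direct_sum_Z2 : set (int -> 'Z_2) :=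
  [set f | finite_set [set n | f n != 0]].

Definition isomorphic_to_direct_sum_Z2 {G : groupType} (Gam : set G) : Prop :=
  exists phi : (int -> 'Z_2) -> G,
    set_bij direct_sum_Z2 Gam phi /\
    {in direct_sum_Z2 &, forall f g, phi (f + g) = (phi f * phi g)%g}.

(* Main.v *)
Require Import Defs.
From HB Require Import structures.
From mathcomp Require Import all_boot all_order all_algebra finmap.
From mathcomp Require Import all_classical all_reals all_analysis.
From mathcomp Require Import zify.

(** Let Gamma be the direct sum of copies of Z/2Z indexed by the integers, and
    cut the integers into disjoint finite blocks [B_0, B_1, ...] with
    [#|B_k| >= k + 2]. Write [P_k] for the finite subgroup of Gamma generated by
    the coordinates in [B_k]. The space is the closed shift-invariant subgroup
    X of [(Z/2Z)^Gamma] formed by the configurations whose sum over every coset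
    of every [P_k] is 0 ([block_code]), and Gamma acts by translation of the
    coordinates. As a subshift the action is expansive.

    Asymptotic points differ by a finitely supported element [z] of X. For any
    [g], choose a block that meets neither [g] nor any group element at which
    [z] is nonzero, these being regarded as finite sets of integers: in the
    coset [g + P_k] the only point where [z] can be nonzero is [g], so the
    equation of that coset says [z g = 0]. Hence [z = 0]
    ([finite_support_eq0]).

    The equations become rarer as the blocks grow, and this leaves positive
    entropy. Given a finite set [F] of coordinates, choose in each block a
    pattern [v k] that is least frequent among the elements of [F]. Discarding
    the elements of [F] that show the pattern [v k] in some block removes at
    most the fraction [2 ^- #|B_k|] for each [k], so a subset [F'] with at least
    half of the elements remains ([avoid_rare_patterns]). For [h] in [F'] the
    indicator of the points that agree, in each block, with [h] or with [v k]
    belongs to X, as it takes the value 1 at zero or two points of each coset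
    of [P_k]; and it restricts to the indicator of [h] on [F']. So all
    functions on [F'] extend to X ([interpolation]), and separating points by
    the coordinate 0 gives covers that need at least [2 ^ (#|F| / 2)] members
    ([ln_cover_number_ge]). The same extension property with a set [F] of two
    elements, where nothing is discarded, shows that the action is faithful, so
    that Gamma embeds in the automorphism group of X. *)

Set Implicit Arguments.
Unset Strict Implicit.
Unset Printing Implicit Defensive.

Import Order.TTheory GRing.Theory Num.Theory.
Import numFieldNormedType.Exports.

Local Open Scope classical_set_scope.
Local Open Scope ring_scope.

(** * The group of finite sets of integers under symmetric difference *)

(** A finitely supported function from the integers to Z/2Z is encoded by its
    support, so that addition becomes symmetric difference. *)
Definition flips := {fset int}.

HB.instance Definition _ := Countable.on flips.

Definition symdiff (a b : flips) : flips :=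
  ((a `\` b) `|` (b `\` a))%fset.

Lemma in_symdiff (a b : flips) i :
  (i \in symdiff a b) = (i \in a) (+) (i \in b).
Proof. by rewrite !inE; case: (i \in a); case: (i \in b). Qed.

Lemma symdiffA : associative symdiff.
Proof. by move=> a b c; apply/fsetP => i; rewrite !in_symdiff addbA. Qed.

Lemma symdiffC : commutative symdiff.
Proof. by move=> a b; apply/fsetP => i; rewrite !in_symdiff addbC. Qed.

Lemma symdiff0 : left_id (fset0 : flips) symdiff.
Proof. by move=> a; apply/fsetP => i; rewrite in_symdiff in_fset0. Qed.

Lemma symdiffV : left_inverse (fset0 : flips) id symdiff.
Proof. by move=> a; apply/fsetP => i; rewrite in_symdiff addbb in_fset0. Qed.

HB.instance Definition _ :=
  GRing.isZmodule.Build flips symdiffA symdiffC symdiff0 symdiffV.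

Lemma in_flips0 i : (i \in (0 : flips)) = false.
Proof. exact: in_fset0. Qed.

Lemma in_flipsD (a b : flips) i : (i \in a + b) = (i \in a) (+) (i \in b).
Proof. exact: in_symdiff. Qed.

Lemma flipsDD (a : flips) : a + a = 0.
Proof. exact: symdiffV. Qed.

(** * Disjoint blocks of integers of growing size *)

(** The blocks are the shells [2^(k+2) <= |i| + 4 < 2^(k+3)]: finite, disjoint,
    covering all integers, and large enough for the sum of the
    [2 ^- #|block k|] to be at most 1/2, which makes the entropy positive. *)
Definition block_of (i : int) : nat := (trunc_log 2 (`|i|%N + 4)%N - 2)%N.

Definition block (k : nat) : flips :=
  [fset i in [seq Posz j | j <- iota 0 (2 ^ k.+3)] ++
             [seq - Posz j | j <- iota 0 (2 ^ k.+3)] | block_of i == k]%fset.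

Lemma block_ofE i k :
  (block_of i == k) = (2 ^ k.+2 <= `|i|%N + 4 < 2 ^ k.+3)%N.
Proof.
have h2 : (2 <= trunc_log 2 (`|i|%N + 4))%N by apply: trunc_log_max; lia.
rewrite /block_of; apply/eqP/idP => [<-|/(@trunc_log_eq 2 _ _ isT) ->]; last lia.
have -> : ((trunc_log 2 (`|i| + 4) - 2).+2 =  trunc_log 2 (`|i| + 4))%N by lia.
by rewrite trunc_logP ?trunc_log_ltn //; lia.
Qed.

Lemma in_block k i : (i \in block k) = (block_of i == k).
Proof.
rewrite !inE /= andb_idl // block_ofE => /andP[_ lt_i].
have {}lt_i : (`|i|%N < 2 ^ k.+3)%N by lia.
rewrite mem_cat; case: i lt_i => j lt_i.
  by apply/orP; left; apply/mapP; exists j; rewrite ?mem_iota.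
by apply/orP; right; apply/mapP; exists j.+1; rewrite ?mem_iota ?NegzE.
Qed.

Lemma card_block k : (k.+2 <= #|` block k|)%N.
Proof.
pose s := [seq Posz j | j <- iota (2 ^ k.+2 - 4) (2 ^ k.+2)].
have us : uniq s by rewrite map_inj_uniq ?iota_uniq // => i j [].
apply: (@leq_trans (size s)).
  by rewrite size_map size_iota ltnW // ltn_expl.
apply: uniq_leq_size us _ => _ /mapP[j + ->]; rewrite mem_iota => /andP[hj1 hj2].
have h4 : (4 <= 2 ^ k.+2)%N by rewrite !expnS; have := expn_gt0 2 k; lia.
have -> : (Posz j \in enum_fset (block k)) = (Posz j \in block k) by [].
by rewrite in_block block_ofE absz_nat [(2 ^ k.+3)%N]expnS; lia.
Qed.

Definition on_block (k : nat) (g : flips) : flips := (g `&` block k)%fset.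

(** The finite subgroup generated by the integers of block [k]; the result
    type makes its elements group elements rather than bare sets. *)
Definition patterns (k : nat) : {fset flips} := fpowerset (block k).

Lemma in_patterns k s : (s \in patterns k) = (s `<=` block k)%fset.
Proof. exact: fpowersetE. Qed.

Lemma card_patterns k : #|` patterns k| = (2 ^ #|` block k|)%N.
Proof. exact: card_fpowerset. Qed.

Lemma on_blockD k g h : on_block k (g + h) = on_block k g + on_block k h.
Proof.
apply/fsetP => i; rewrite in_flipsD !in_fsetI in_flipsD.
by case: (i \in block k); rewrite ?andbF ?andbT.
Qed.

Lemma on_block_sub k g : on_block k g \in patterns k.
Proof. by rewrite in_patterns fsubsetIr. Qed.

Lemma on_block_id k s : s \in patterns k -> on_block k s = s.
Proof. by rewrite in_patterns => /fsetIidPl. Qed.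

Lemma on_block_other j k s :
  s \in patterns k -> j != k -> on_block j s = 0.
Proof.
rewrite in_patterns => /fsubsetP sk /eqP jk; apply/fsetP => i.
rewrite in_flips0 in_fsetI; apply/negP => /andP[/sk].
by rewrite !in_block => /eqP -> /eqP /esym.
Qed.

Lemma on_block_inj g h : (forall k, on_block k g = on_block k h) -> g = h.
Proof.
move=> gh; apply/fsetP => i.
by have /fsetP/(_ i) := gh (block_of i); rewrite !in_fsetI in_block eqxx !andbT.
Qed.

Lemma card_pattern k v (F : {fset flips}) :
  #|` [fset f in F | on_block k f == v]%fset| =
  (\sum_(f <- F) (on_block k f == v))%N.
Proof.
rewrite -sum1_size big_fset /= big_mkcond /=.
by apply: eq_bigr => f _; case: ifP.
Qed.

(** Pigeonhole: the [2 ^ #|block k|] patterns share the elements of [F], so one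
    of them has at most the average number. *)
Lemma rare_pattern k (F : {fset flips}) :
  exists2 v, v \in patterns k &
    (#|` [fset f in F | on_block k f == v]%fset| * 2 ^ #|` block k| <= #|` F|)%N.
Proof.
pose c v := #|` [fset f in F | on_block k f == v]%fset|.
pose m := #|` block k|.
have tot : (\sum_(v <- patterns k) c v = #|` F|)%N.
  under eq_bigr do rewrite /c card_pattern.
  rewrite exchange_big /= -sum1_size; apply: eq_bigr => f _.
  rewrite (bigD1_seq (on_block k f)) ?on_block_sub ?fset_uniq //= eqxx.
  by rewrite big1 ?addn0 // => v; rewrite eq_sym => /negPf ->.
apply: contrapT => no.
have big : (\sum_(v <- patterns k) #|` F|.+1
    <= \sum_(v <- patterns k) c v * 2 ^ m)%N.
  rewrite big_seq [leqRHS]big_seq; apply: leq_sum => v vk.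
  by rewrite ltnNge; apply/negP => le; apply: no; exists v.
have pos : (0 < 2 ^ m)%N by rewrite expn_gt0.
move: big; rewrite big_const_seq count_predT iter_addn_0 -big_distrl /= tot.
by rewrite card_patterns -/m leq_pmul2r // ltnn.
Qed.

(** The sum over [k] of [n / 2^(k+2)] is at most [n / 2]. *)
Lemma sum_geometric_bound (c : nat -> nat) n K :
  (forall k, c k * 2 ^ k.+2 <= n)%N -> (2 * \sum_(k < K) c k <= n)%N.
Proof.
move=> cn.
(* The slack [n / 2^(K+1)] left by a finite sum carries the induction. *)
suff H : ((\sum_(k < K) c k) * 2 ^ K.+1 + n <= n * 2 ^ K)%N.
  have pos : (0 < 2 ^ K)%N by rewrite expn_gt0.
  by rewrite -(leq_pmul2r pos); rewrite expnS in H; nia.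
elim: K => [|K IH]; first by rewrite big_ord0; lia.
rewrite big_ord_recr /=; have := cn K; move: IH; rewrite !expnS.
move: (\sum_(i < K) c i)%N (2 ^ K)%N (c K) => S P C; nia.
Qed.

(** * The code and its finite patterns *)

(** Seen as a module over F_2[Gamma], which is generated by the
    [X_i = 1 + e_i] subject to [X_i ^ 2 = 0], the dual of this subgroup is the
    quotient by the monomial ideal generated by the products of the [X_i]
    over each block. *)
Definition block_code (x : flips -> 'Z_2) : Prop :=
  forall k (g : flips), \sum_(s <- patterns k) x (g + s) = 0.

Definition two_pattern (v : nat -> flips) (h g : flips) : 'Z_2 :=
  (`[< forall k, on_block k g = on_block k h \/ on_block k g = v k >] : nat)%:R.

(** On a coset of a block, either a condition on another block fails and the
    function vanishes, or it is 1 at exactly two points, because [h] and [v k]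
    differ on that block; both sums are 0 modulo 2. *)
Lemma two_pattern_code v h :
  (forall k, v k \in patterns k) ->
  (forall k, on_block k h <> v k) -> block_code (two_pattern v h).
Proof.
move=> vB hv k g.
have [off|noff] := pselect
    (forall j, j != k -> on_block j g = on_block j h \/ on_block j g = v j).
  (* The two shifts that bring [g] to [h], respectively to [v k], on the block. *)
  pose s1 := on_block k g + on_block k h; pose s2 := on_block k g + v k.
  have s1B : s1 \in patterns k by rewrite /s1 -on_blockD on_block_sub.
  have s2B : s2 \in patterns k.
    by rewrite /s2 -(on_block_id (vB k)) -on_blockD on_block_sub.
  have s12 : s1 != s2 by apply/eqP => /addrI /hv.
  have E s : s \in patterns k ->
      two_pattern v h (g + s) = ((s == s1) + (s == s2))%:R.
    move=> sB; rewrite /two_pattern; congr (_%:R).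
    have solve c : (on_block k (g + s) = c) <-> s = on_block k g + c.
      rewrite on_blockD (on_block_id sB); split=> [<-|->].
        by rewrite addrA flipsDD add0r.
      by rewrite addrA flipsDD add0r.
    have -> : `[< forall j, on_block j (g + s) = on_block j h \/
                 on_block j (g + s) = v j >] = (s == s1) || (s == s2).
      apply/asboolP/orP => [/(_ k)[/solve ->|/solve ->]|ss j].
      - by left.
      - by right.
      have [->|jk] := eqVneq j k.
        by case: ss => /eqP ss; [left|right]; apply/solve.
      by rewrite on_blockD (on_block_other sB jk) addr0; exact: off.
    by case: (eqVneq s s1) => // ->; rewrite (negPf s12).
  have one t : t \in patterns k ->
      \sum_(s <- patterns k) ((s == t)%:R : 'Z_2) = 1.
    move=> tB; rewrite (bigD1_seq t) ?fset_uniq //= eqxx.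
    by rewrite big1 ?addr0 // => s /negPf ->.
  rewrite big_seq; under eq_bigr => s sB do rewrite (E s sB) natrD.
  by rewrite -big_seq big_split /= !one //; apply/val_inj.
rewrite big_seq big1 // => s sB; rewrite /two_pattern.
case: asboolP => // allj; case: noff => j jk.
by have := allj j; rewrite on_blockD (on_block_other sB jk) addr0.
Qed.

(** Away from the patterns [v k] only the alternative of agreeing with [h] in
    every block is left, and the blocks cover all integers. *)
Lemma two_pattern_delta v h g :
  (forall k, on_block k g <> v k) -> two_pattern v h g = (g == h)%:R.
Proof.
move=> gv; rewrite /two_pattern; congr (_%:R); congr nat_of_bool.
apply/asboolP/eqP => [gh|->]; last by left.
by apply: on_block_inj => k; have [//|/gv] := gh k.
Qed.

(** Discarding from [F] the elements with a rare pattern in some block costs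
    at most [#|F| / 2^(k+2)] of them for block [k], hence at most half of [F]
    altogether. When [#|F| <= 2] each of these numbers is less than 1, so that
    nothing is discarded; this case separates two given group elements. *)
Lemma avoid_rare_patterns (F : {fset flips}) :
  exists (v : nat -> flips) (F' : {fset flips}),
    [/\ (forall k, v k \in patterns k), (F' `<=` F)%fset,
        {in F', forall f k, on_block k f <> v k},
        (#|` F| <= 2 * #|` F'|)%N & (#|` F| <= 2 -> F' = F)%N].
Proof.
have /choice[v vP] : forall k, exists v, v \in patterns k /\
    (#|` [fset f in F | on_block k f == v]%fset| * 2 ^ #|` block k| <= #|` F|)%N.
  by move=> k; have [v ? ?] := rare_pattern k F; exists v.
pose c k := #|` [fset f in F | on_block k f == v k]%fset|.
have cF k : (c k * 2 ^ k.+2 <= #|` F|)%N.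
  apply: leq_trans (vP k).2; rewrite leq_mul2l leq_exp2l ?card_block ?orbT //.
pose F' := [fset f in F | `[< forall k, on_block k f <> v k >]]%fset.
have F'P f : f \in F' -> forall k, on_block k f <> v k.
  by rewrite !inE /= => /andP[_ /asboolP].
have bad f : f \in F -> f \notin F' -> exists k, on_block k f = v k.
  rewrite !inE /= => -> /= /asboolP /existsNP[k /contrapT fk]; by exists k.
have bad_pos f k : f \in F -> on_block k f = v k -> (0 < c k)%N.
  move=> fF fk; rewrite /c cardfs_gt0; apply/fset0Pn; exists f.
  by rewrite !inE /= fF fk eqxx.
exists v, F'; split.
- by move=> k; exact: (vP k).1.
- by apply/fsubsetP => f; rewrite !inE /= => /andP[].
- by move=> f /F'P.
- have [N NE] : exists N, N = #|` F| by exists #|` F|.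
  have small k : (0 < c k)%N -> (k < N)%N.
    rewrite NE; have := cF k; have : (k < 2 ^ k)%N by rewrite ltn_expl.
    by rewrite !expnS; nia.
  have := sum_geometric_bound N cF.
  suff : (#|` F| <= #|` F'| + \sum_(k < N) c k)%N by lia.
  under eq_bigr do rewrite /c card_pattern.
  rewrite exchange_big /= -!sum1_size big_fset /= [in leqRHS]big_mkcond /=.
  rewrite -big_split /= big_seq [leqRHS]big_seq; apply: leq_sum => f fF.
  case: asboolP => // /existsNP[k /contrapT fk].
  rewrite (bigD1 (Ordinal (small _ (bad_pos _ _ fF fk)))) //= fk eqxx.
  by rewrite add0n leq_addr.
- move=> F2; apply/fsetP => f; apply/idP/idP; first by rewrite !inE /= => /andP[].
  move=> fF; apply/negPn/negP => /(bad _ fF)[k /(bad_pos _ _ fF) ck].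
  by have := cF k; have := expn_gt0 2 k; rewrite !expnS; nia.
Qed.

(** * The compact group *)

Record config := Config {
  config_fun :> flips -> 'Z_2;
  configP : block_code config_fun }.

Lemma config_eq (x y : config) : x =1 y -> x = y.
Proof.
case: x y => [f Pf] [g Pg] /= /funext fg.
by case: g / fg in Pg *; congr Config; exact: Prop_irrelevance.
Qed.

HB.instance Definition _ := gen_eqMixin config.
HB.instance Definition _ := gen_choiceMixin config.

Lemma block_code0 : block_code (fun=> 0).
Proof. by move=> k g; rewrite big1. Qed.

Lemma block_codeN x : block_code x -> block_code (fun g => - x g).
Proof. by move=> Px k g; rewrite sumrN Px oppr0. Qed.

Lemma block_codeD x y :
  block_code x -> block_code y -> block_code (fun g => x g + y g).
Proof. by move=> Px Py k g; rewrite big_split /= Px Py addr0. Qed.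

Lemma block_code_shift a x : block_code x -> block_code (fun g => x (g + a)).
Proof.
by move=> Px k g; rewrite -[RHS](Px k (g + a)); under eq_bigr do rewrite addrAC.
Qed.

Definition config_add (x y : config) := Config (block_codeD (configP x) (configP y)).
Definition config_opp (x : config) := Config (block_codeN (configP x)).

Lemma config_addA : associative config_add.
Proof. by move=> x y z; apply: config_eq => g /=; rewrite addrA. Qed.
Lemma config_addC : commutative config_add.
Proof. by move=> x y; apply: config_eq => g /=; rewrite addrC. Qed.
Lemma config_add0 : left_id (Config block_code0) config_add.
Proof. by move=> x; apply: config_eq => g /=; rewrite add0r. Qed.
Lemma config_addN : left_inverse (Config block_code0) config_opp config_add.
Proof. by move=> x; apply: config_eq => g /=; rewrite addNr. Qed.

HB.instance Definition _ :=
  GRing.isZmodule.Build config config_addA config_addC config_add0 config_addN.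

Lemma config_sumE (I : Type) (r : seq I) (P : pred I) (f : I -> config) g :
  (\sum_(i <- r | P i) f i) g = \sum_(i <- r | P i) f i g.
Proof. by apply: (big_morph (fun x : config => x g)). Qed.

(** The topology of pointwise convergence: a basic neighbourhood fixes finitely
    many coordinates. *)
Definition cylinder (x : config) (S : seq flips) : set config :=
  [set y | {in S, x =1 y}].

Definition config_nbhs (x : config) : set_system config :=
  [set A | exists S, cylinder x S `<=` A].

HB.instance Definition _ := hasNbhs.Build config config_nbhs.

Lemma config_nbhs_filter (x : config) : ProperFilter (nbhs x).
Proof.
split=> [[S /(_ x)]|]; first by apply=> ?.
split.
- by exists [::].
- move=> A B [S SA] [T TB]; exists (S ++ T) => y xy.
  by split; [apply: SA|apply: TB] => g gS; apply: xy; rewrite mem_cat gS ?orbT.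
- by move=> A B AB [S SA]; exists S; exact: subset_trans AB.
Qed.

Lemma config_nbhs_singleton (x : config) A : nbhs x A -> A x.
Proof. by move=> [S]; apply => ?. Qed.

Lemma config_nbhs_nbhs (x : config) A : nbhs x A -> nbhs x (nbhs^~ A).
Proof.
move=> [S SA]; exists S => y xy; exists S => z yz.
by apply: SA => g gS; rewrite xy // yz.
Qed.

HB.instance Definition _ := Nbhs_isNbhsTopological.Build config
  config_nbhs_filter config_nbhs_singleton config_nbhs_nbhs.

Lemma nbhs_cylinder (x : config) S : nbhs x (cylinder x S).
Proof. by exists S. Qed.

Lemma continuous_sub_config : continuous (fun z : config * config => z.1 - z.2).
Proof.
move=> [x y] A [S SA].
exists (cylinder x S, cylinder y S); first by split; exact: nbhs_cylinder.
move=> [x' y'] [/= xx yy]; apply: SA => g gS /=.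
by rewrite xx // yy.
Qed.

HB.instance Definition _ :=
  PreTopologicalNmodule_isTopologicalZmodule.Build config continuous_sub_config.

Lemma clopen_coord g c : clopen [set x : config | x g = c].
Proof.
split; rewrite ?openE.
  by move=> x /= xg; exists [:: g] => y /= <- //; rewrite mem_head.
rewrite -[X in closed X]setCK; apply: open_closedC.
rewrite openE => x /= xg; exists [:: g] => y xy /= yg; apply: xg.
by rewrite xy ?mem_head.
Qed.

Lemma config_neq (x y : config) : x <> y -> exists g, x g <> y g.
Proof. by move=> xy; apply/existsNP => xEy; exact/xy/config_eq. Qed.

Lemma totally_disconnected_config : totally_disconnected [set: config].
Proof.
apply: zero_dimension_totally_disconnected => x y /eqP /config_neq[g xyg].
exists [set z : config | z g = x g]; split=> //; first exact: clopen_coord.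
by move=> /= /esym.
Qed.

Lemma Z2P (c : 'Z_2) : c = 0 \/ c = 1.
Proof. by case: c => [[|[|//]] ?]; [left|right]; apply/val_inj. Qed.

(** An ultrafilter has a limit at each coordinate, since the alphabet is finite.
    The limit satisfies the code, because each equation of the code involves
    finitely many coordinates, on which some element of the code agrees with
    the limit. *)
Lemma compact_config : compact [set: config].
Proof.
rewrite compact_ultra => F FU _ /=.
have FF := @ultra_proper _ _ FU.
have /choice[f Ff] : forall g, exists c : 'Z_2, F [set x : config | x g = c].
  move=> g; have [F0|F1] := in_ultra_setVsetC [set x : config | x g = 0] FU.
    by exists 0.
  exists 1; apply: filterS F1 => x /=.
  by have [->|] := Z2P (x g).
have FS (S : seq flips) : F [set x : config | {in S, f =1 x}].
  elim: S => [|g S IH]; first by apply: filterS filterT.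
  apply: filterS (filterI (Ff g) IH) => x /= [xg xS] h.
  by rewrite inE => /predU1P[->|/xS].
have fP : block_code f.
  move=> k g; have /filter_ex[x fx] := FS [seq g + s | s <- patterns k].
  rewrite -[RHS](configP x k g) big_seq [RHS]big_seq; apply: eq_bigr => s sk.
  by rewrite fx //; apply/mapP; exists s.
exists (Config fP); split=> // A [S SA].
by apply: filterS (FS S).
Qed.

(** * The action *)

Definition shift (a : flips) (x : config) : config :=
  Config (block_code_shift a (configP x)).

Lemma shiftE a x g : shift a x g = x (g + a).
Proof. by []. Qed.

Lemma shiftD a b x : shift (a + b) x = shift a (shift b x).
Proof. by apply: config_eq => g; rewrite !shiftE addrA. Qed.

Lemma shift0 x : shift 0 x = x.
Proof. by apply: config_eq => g; rewrite shiftE addr0. Qed.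

Lemma shiftK a : cancel (shift a) (shift a).
Proof. by move=> x; rewrite -shiftD flipsDD shift0. Qed.

Lemma continuous_shift a : continuous (shift a).
Proof.
move=> x A [S SA]; exists [seq g + a | g <- S] => y xy.
by apply: SA => g gS; rewrite !shiftE; apply: xy; apply: map_f.
Qed.

Lemma shift_automorphism a : is_automorphism (shift a).
Proof.
split; [|exact: continuous_shift|].
  by move=> x y; apply: config_eq.
exists (shift a); split; [exact: continuous_shift|exact: shiftK|exact: shiftK].
Qed.

Definition tau (a : flips) : Aut config := MkAut (shift_automorphism a).

Lemma tauD a b : tau (a + b) = (tau a * tau b)%g.
Proof. by apply: autP => x; exact: shiftD. Qed.

Lemma tau0 : tau 0 = 1%g.
Proof. by apply: autP => x; exact: shift0. Qed.

Lemma tauV a : (tau a)^-1%g = tau a.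
Proof.
by apply: mulg1_eq; rewrite -tauD flipsDD tau0.
Qed.

(** The combinatorial core: at least half of any finite set of coordinates is
    free for the code. Sums of the functions [two_pattern v h] over [h] in [P]
    realise the indicator of [P] on the free coordinates. *)
Lemma interpolation (F : {fset flips}) :
  exists F' : {fset flips},
    [/\ (F' `<=` F)%fset, (#|` F| <= 2 * #|` F'|)%N,
        (#|` F| <= 2 -> F' = F)%N
      & forall P : {fset flips}, (P `<=` F')%fset ->
          exists x : config, {in F', forall g, x g = (g \in P)%:R}].
Proof.
have [v [F' [vB F'F F'v F'2 F'E]]] := avoid_rare_patterns F.
exists F'; split=> // P PF'.
(* The value 0 only makes [b] total; [b] is used on [F'] alone. *)
pose b h : config :=
  if pselect (forall k, on_block k h <> v k) is left hv then
    Config (two_pattern_code vB hv) else 0.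
have bE h g : h \in F' -> g \in F' -> b h g = (g == h)%:R.
  move=> hF gF; rewrite /b; case: pselect => [hv|[]]; last exact: F'v.
  by rewrite /= two_pattern_delta //; exact: F'v.
exists (\sum_(h <- P) b h) => g gF; rewrite config_sumE.
rewrite big_seq; under eq_bigr => h hP do rewrite (bE h g (fsubsetP PF' _ hP) gF).
rewrite -big_seq; have [gP|gP] := boolP (g \in P).
  rewrite (bigD1_seq g) ?fset_uniq //= eqxx big1 ?addr0 // => h.
  by rewrite eq_sym => /negPf ->.
rewrite big_seq big1 // => h hP; case: eqP => // gh.
by rewrite gh hP in gP.
Qed.

(** The action is faithful because a point of the code can take different
    values at two given coordinates. *)
Lemma tau_inj : injective tau.
Proof.
move=> a b ab; apply: contrapT => /eqP nab.
have [F' [_ _ F'E int]] := interpolation [fset a; b]%fset.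
have {}F'E : F' = [fset a; b]%fset by apply: F'E; rewrite cardfs2; case: (_ != _).
have [|x xP] := int [fset a]%fset; first by rewrite F'E fsub1set !inE eqxx.
have := congr1 (fun t : Aut config => t x 0) ab.
rewrite /= !add0r !xP ?F'E !inE ?eqxx ?orbT //= eq_sym (negPf nab).
by [].
Qed.

(** * A compatible metric *)

Lemma seq_bound (T : eqType) (f : T -> nat) (s : seq T) :
  exists K, {in s, forall x, (f x < K)%N}.
Proof.
elim: s => [|a s [K sK]]; first by exists 0.
exists (maxn (f a).+1 K) => x; rewrite inE leq_max => /predU1P[->|/sK ->].
  by rewrite ltnSn.
by rewrite orbT.
Qed.

Section Metric.
Context {R : realType}.

Definition weight (g : flips) : R := (choice.pickle g).+1%:R^-1.

Lemma weight_gt0 g : 0 < weight g. Proof. by rewrite invr_gt0. Qed.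

Definition diff_weights (x y : config) : set R :=
  [set 0] `|` [set weight g | g in [set g | x g <> y g]].

(** The supremum makes the comparison with a bound a statement about each
    coordinate; the value 0 keeps the set nonempty when [x = y]. *)
Definition dist (x y : config) : R := sup (diff_weights x y).

Lemma dist_le (x y : config) e :
  dist x y <= e <-> 0 <= e /\ forall g, x g <> y g -> weight g <= e.
Proof.
have ub : has_ubound (diff_weights x y).
  exists 1 => _ [->|[g _ <-]]; first exact: ler01.
  by rewrite invf_le1 // ler1n.
split=> [le_e|[e0 le_e]].
  split=> [|g gxy]; apply: le_trans le_e; apply: ub_le_sup => //; first by left.
  by right; exists g.
apply: ge_sup; first by exists 0; left.
by move=> _ [->|[g gxy <-]] //; exact: le_e.
Qed.

Lemma dist_ge0 x y : 0 <= dist x y.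
Proof. by have /dist_le[] := lexx (dist x y). Qed.

Lemma weight_le_dist (x y : config) g : x g <> y g -> weight g <= dist x y.
Proof. by have /dist_le[_] := lexx (dist x y); apply. Qed.

Lemma dist_sym x y : dist x y = dist y x.
Proof.
apply/le_anti/andP; split; apply/dist_le; split; rewrite ?dist_ge0 // => g ne;
  by apply: weight_le_dist => /esym.
Qed.

Lemma dist_triangle x y z : dist x z <= dist x y + dist y z.
Proof.
apply/dist_le; split=> [|g xz]; first by rewrite addr_ge0 ?dist_ge0.
have [xy|xy] := eqVneq (x g) (y g).
  rewrite ler_wpDl ?dist_ge0 //; apply: weight_le_dist.
  by rewrite -xy.
by rewrite ler_wpDr ?dist_ge0 //; apply: weight_le_dist; exact/eqP.
Qed.

Lemma dist_eq0 x y : dist x y = 0 <-> x = y.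
Proof.
split=> [d0|->].
  apply: contrapT => /config_neq[g /weight_le_dist].
  by rewrite d0 leNgt weight_gt0.
by apply/le_anti; rewrite dist_ge0 andbT; apply/dist_le; split.
Qed.

Lemma compatible_dist : compatible_metric dist.
Proof.
split; [exact: dist_eq0|exact: dist_sym|exact: dist_triangle|].
move=> x A; split=> [[S SA]|[e e0 eA]].
  have [K SK] := seq_bound choice.pickle S.
  exists K.+1%:R^-1; first by rewrite invr_gt0.
  move=> y /= xy; apply: SA => g gS; apply: contrapT => /weight_le_dist.
  apply/negP; rewrite -ltNge (lt_le_trans xy) // lef_pV2 ?posrE //.
  by rewrite ler_nat ltnS ltnW // SK.
have [n _ /(_ n (leqnn n)) ne] := near_infty_natSinv_lt (PosNum e0).
exists (pmap choice.unpickle (iota 0 n)) => y xy; apply: eA => /=.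
apply: le_lt_trans ne; apply/dist_le; split=> [|g gxy]; first by rewrite invr_ge0.
rewrite lef_pV2 ?posrE // ler_nat ltnS leqNgt; apply/negP => gn.
by apply: gxy; apply: xy; rewrite mem_pmap -choice.pickleK map_f // mem_iota.
Qed.

End Metric.

(** * The acting group *)

Definition Gam : set (Aut config) := range tau.

Lemma tau_Gam a : Gam (tau a). Proof. by exists a. Qed.

Lemma group_closed_Gam : group_closed (mem Gam).
Proof.
split; first by rewrite inE; exists 0; rewrite // tau0.
move=> g h; rewrite !inE => -[a _ <-] [b _ <-].
by exists (a + b); rewrite // tauV tauD.
Qed.

Lemma countable_Gam : countable Gam.
Proof. exact: card_le_trans (card_image_le _ _) (countableP _). Qed.

Lemma commute_Gam : {in Gam &, forall g h, (g * h = h * g)%g}.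
Proof.
by move=> g h; rewrite !inE => -[a _ <-] [b _ <-]; rewrite -!tauD addrC.
Qed.

Lemma flips_bound (S : seq flips) :
  exists K, {in S, forall (g : flips) i, i \in g -> (block_of i < K)%N}.
Proof.
have [K SK] := seq_bound block_of (flatten [seq enum_fset (g : {fset int}) | g <- S]).
exists K => g gS i ig; apply: SK; apply/flattenP; exists (enum_fset g) => //.
by apply/mapP; exists g.
Qed.

(** The finite subgroups supported on the first [n] blocks exhaust the group,
    and form a Folner sequence: each element belongs to all but finitely many
    of them, and leaves those invariant. *)
Definition below_block (n : nat) : {fset flips} :=
  fpowerset [fset i in flatten [seq enum_fset (block k) | k <- iota 0 n]]%fset.

Lemma in_below_block n (a : flips) :
  a \in below_block n <-> forall i, i \in a -> (block_of i < n)%N.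
Proof.
have E i : (i \in [fset i in flatten [seq enum_fset (block k) | k <- iota 0 n]]%fset)
   = (block_of i < n)%N.
  rewrite inE /=; apply/flattenP/idP => [[_ /mapP[k + ->]]|lt_n].
    rewrite mem_iota => /andP[_ kn] ik.
    by have /eqP-> : block_of i == k by rewrite -in_block.
  exists (enum_fset (block (block_of i))).
    by apply/mapP; exists (block_of i); rewrite ?mem_iota.
  by have := in_block (block_of i) i; rewrite eqxx.
rewrite fpowersetE; split=> [/fsubsetP an i /an|an]; first by rewrite E.
by apply/fsubsetP => i /an; rewrite E.
Qed.

Lemma below_blockD n a b :
  a \in below_block n -> b \in below_block n -> a + b \in below_block n.
Proof.
move=> /in_below_block an /in_below_block bn; apply/in_below_block => i.
rewrite in_flipsD.
by have [/an//|_ /bn] := boolP (i \in a).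
Qed.

Lemma amenable_Gam (R : realType) : amenable R Gam.
Proof.
exists (fun n => [fset tau a | a in below_block n]%fset); split.
- move=> n; apply/fset0Pn; exists (tau 0); apply/imfsetP; exists 0 => //=.
  by apply/in_below_block => i; rewrite in_flips0.
- by move=> n _ /imfsetP[a _ ->]; exact: tau_Gam.
move=> _ [a _ <-] /=; apply: cvg_near_cst.
have [K aK] := flips_bound [:: a].
exists K => // n /= Kn.
have an : a \in below_block n.
  by apply/in_below_block => i /aK; rewrite mem_head => /(_ isT) /leq_trans; apply.
set Fn := [fset tau b | b in below_block n]%fset.
have -> : [fset (tau a * h)%g | h in Fn]%fset = Fn.
  apply/fsetP => h; apply/imfsetP/imfsetP => /= -[].
    move=> _ /imfsetP[/= b bn ->] ->; exists (a + b); last by rewrite tauD.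
    exact: below_blockD.
  move=> b bn ->; exists (tau (a + b)); last by rewrite -tauD addrA flipsDD add0r.
  by apply/imfsetP; exists (a + b) => //=; exact: below_blockD.
by rewrite fsetDv fset0U cardfs0 mul0r.
Qed.

(** * Expansiveness and asymptotic pairs *)

(** Translating moves a disagreement at [a] to the coordinate 0. *)
Lemma far_tau (R : realType) (x y : config) a :
  x a <> y a -> weight 0 / 2 < dist (tau a x) (tau a y) :> R.
Proof.
move=> xya; apply: (@lt_le_trans _ _ (weight 0)).
  by rewrite ltr_pdivrMr // ltr_pMr ?weight_gt0 // ltr1n.
by apply: weight_le_dist; rewrite /= add0r.
Qed.

Lemma expansive_Gam (R : realType) : expansive (@dist R) (@aut_fun config) Gam.
Proof.
exists (weight 0 / 2); first by rewrite divr_gt0 ?weight_gt0.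
move=> x y /config_neq[g /(far_tau R) ?]; exists (tau g) => //.
exact: tau_Gam.
Qed.

(** In a block so far away that it meets neither [g] nor any element of the
    support of [z], the sum over the coset of [g] has [z g] as its only possibly nonzero
    term. *)
Lemma finite_support_eq0 (z : config) :
  finite_set [set g | z g <> 0] -> z = 0.
Proof.
move=> /finite_seqP[S SE]; apply: config_eq => g; apply: contrapT => zg.
have [K SK] := flips_bound (g :: S).
apply: zg; rewrite -[RHS](configP z K g).
have p0 : (0 : flips) \in patterns K by rewrite in_patterns fsub0set.
rewrite (bigD1_seq (0 : flips)) ?fset_uniq //= addr0 big_seq_cond big1 ?addr0 //.
move=> s /andP[sK s0]; apply: contrapT => zgs.
have gsS : g + s \in S by have : [set` S] (g + s) by rewrite -SE.
have /fset0Pn[i is_] : (s : {fset int}) != fset0 by exact: s0.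
have : i \in block K by move: sK; rewrite in_patterns => /fsubsetP; apply.
rewrite in_block => /eqP iK.
have [ig|nig] := boolP (i \in g).
  by have := SK g (mem_head _ _) i ig; rewrite iK ltnn.
have := SK (g + s); rewrite inE gsS orbT => /(_ isT i).
by rewrite in_flipsD (negPf nig) is_ iK ltnn => /(_ isT).
Qed.

(** By expansiveness the difference of asymptotic points has finite support. *)
Lemma asymptotic_Gam (R : realType) x y :
  asymptotic_pair (@dist R) (@aut_fun config) Gam x y -> x = y.
Proof.
move=> /(_ (weight 0 / 2)); rewrite divr_gt0 ?weight_gt0 // => /(_ isT) fin.
apply/eqP; rewrite -subr_eq0; apply/eqP; apply: finite_support_eq0.
apply: sub_finite_set (finite_preimage _ fin); last first.
  by move=> a b _ _; exact: tau_inj.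
move=> g /= /eqP; rewrite subr_eq0 => /eqP xyg.
by split; [exact: tau_Gam | exact: far_tau].
Qed.

(** * The isomorphism with the direct sum *)

Definition flip_support (f : int -> 'Z_2) : flips := fset_set [set n | f n != 0].

Lemma isomorphic_Gam : isomorphic_to_direct_sum_Z2 Gam.
Proof.
have supE f i : f \in direct_sum_Z2 -> (i \in flip_support f) = (f i != 0).
  rewrite inE => ff; rewrite in_fset_set // -[RHS]asboolb.
  by apply/idP/asboolP; rewrite inE.
exists (tau \o flip_support); split; first split.
- by move=> f _; exact: tau_Gam.
- move=> f g ff gg /= /tau_inj fg; apply/funext => i.
  have := supE f i ff; rewrite fg (supE g i gg).
  by have [->|->] := Z2P (f i); have [->|->] := Z2P (g i).
- move=> _ [a _ <-].
  pose f i : 'Z_2 := (i \in a)%:R.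
  have fE : [set n | f n != 0] = [set` a].
    by apply/seteqP; split=> i /=; rewrite /f; case: (i \in a).
  have ff : direct_sum_Z2 f by rewrite /direct_sum_Z2 /= fE; exact: finite_fset.
  exists f => //=; congr tau; apply/fsetP => i; rewrite supE ?inE // /f.
  by case: (i \in a).
move=> f g ff gg /=; rewrite -tauD; congr tau; apply/fsetP => i.
rewrite in_flipsD !supE //.
  change ((f + g) i) with (f i + g i).
  by have [->|->] := Z2P (f i); have [->|->] := Z2P (g i).
rewrite inE /direct_sum_Z2 /=; move: ff gg; rewrite !inE => ff gg.
apply: sub_finite_set (_ : finite_set ([set n | f n != 0] `|` [set n | g n != 0])).
  move=> n /=; apply: contraPP => /not_orP[/negP/negPn/eqP fn /negP/negPn/eqP gn].
  change ((f + g) n) with (f n + g n).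
  by rewrite fn gn addr0 eqxx.
by rewrite finite_setU.
Qed.

(** * Entropy *)

Definition coord_cover : set (set config) :=
  [set [set x : config | x 0 = c] | c in [set: 'Z_2]].

Lemma coord_cover_open : finite_open_cover coord_cover.
Proof.
split.
- exact: finite_image.
- by move=> _ [c _ <-]; exact: (clopen_coord 0 c).1.
- by rewrite -subTset => x _; exists [set y : config | y 0 = x 0] => //; exists (x 0).
Qed.

Definition untau (g : Aut config) : flips := xget 0 [set a | tau a = g].

Lemma untauK g : Gam g -> tau (untau g) = g.
Proof. by move=> [a _ ag]; apply: (@xgetPex _ 0 [set a | tau a = g]); exists a. Qed.

Lemma joined_coord_eq (F : {fset Aut config}) A a x y :
  joined_cover (@aut_fun config) coord_cover F A -> tau a \in F ->
  A x -> A y -> x a = y a.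
Proof.
move=> [C CU <-] aF Ax Ay.
have [c _ cE] := CU _ aF.
have := Ax _ aF; have := Ay _ aF; rewrite /preimage /= -cE /= !add0r.
by move=> -> ->.
Qed.

(** By interpolation at least [2 ^ (#|F| / 2)] patterns occur on the coordinates
    indexed by [F], and points with different patterns lie in different members
    of the joined cover. *)
Lemma ln_cover_number_ge (R : realType) (F : {fset Aut config}) :
  [set` F] `<=` Gam ->
  #|` F|%:R * ln 2 <=
    2 * ln (cover_number R (joined_cover (@aut_fun config) coord_cover F)).
Proof.
move=> FG.
pose act := @aut_fun config.
pose Fa := [fset untau g | g in F]%fset.
have FaF a : a \in Fa -> tau a \in F.
  by move=> /imfsetP[g gF ->]; rewrite untauK //; exact: FG.
have cardFa : #|` Fa| = #|` F|.
  rewrite card_in_imfset //= => g h gF hF gh.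
  by rewrite -(untauK (FG _ gF)) gh untauK //; exact: FG.
have [F' [F'F F'2 _ int]] := interpolation Fa.
rewrite cardFa in F'2.
have lower (V : {fset set config}) : [set` V] `<=` joined_cover act coord_cover F ->
    \bigcup_(A in [set` V]) A = [set: config] -> (2 ^ #|` F'| <= #|` V|)%N.
  move=> VJ Vc.
  have /choice[h hP] : forall P : {fset flips}, exists A : set config,
      (P `<=` F')%fset ->
      A \in V /\ exists2 x, A x & {in F', forall g, x g = (g \in P)%:R}.
    move=> P; have [PF'|] := boolP (P `<=` F')%fset; last by exists set0.
    have [x xP] := int P PF'.
    have : [set: config] x by [].
    by rewrite -Vc => -[A AV Ax]; exists A; split=> //; exists x.
  rewrite -card_fpowerset.
  have <- : #|` [fset h P | P in fpowerset F']%fset| = #|` fpowerset F'|.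
    rewrite card_in_imfset //= => P Q; rewrite !fpowersetE => PF QF hPQ.
    have [PV [x Px xP]] := hP P PF; have [QV [y Qy yQ]] := hP Q QF.
    apply/fsetP => g; have [gF'|ngF'] := boolP (g \in F'); last first.
      by rewrite (contraNF (fsubsetP PF g)) // (contraNF (fsubsetP QF g)).
    have : x g = y g.
      apply: (joined_coord_eq (VJ _ PV)) => //; last by rewrite hPQ.
      by apply: FaF; exact: (fsubsetP F'F).
    by rewrite xP // yQ //; case: (g \in P); case: (g \in Q).
  apply: fsubset_leq_card; apply/fsubsetP => _ /imfsetP[/= P + ->].
  by rewrite fpowersetE => PF; have [] := hP P PF.
(* An explicit finite subcover: the infimum of the empty set would be 0. *)
have ex : exists V : {fset set config}, [set` V] `<=` joined_cover act coord_cover F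
   /\ \bigcup_(A in [set` V]) A = [set: config].
  pose C (P : {fset flips}) (g : Aut config) :=
    [set x : config | x 0 = (untau g \in P)%:R].
  exists [fset \bigcap_(g in [set` F]) (act g @^-1` C P g) | P in fpowerset Fa]%fset.
  split.
    move=> _ /imfsetP[/= P _ ->]; exists (C P) => // g gF.
    by exists (untau g \in P)%:R.
  rewrite -subTset => x _.
  pose P := [fset a in Fa | x a == 1]%fset.
  exists (\bigcap_(g in [set` F]) (act g @^-1` C P g)).
    apply/imfsetP; exists P => //=; rewrite fpowersetE.
    by apply/fsubsetP => a; rewrite !inE /= => /andP[].
  move=> g gF; rewrite /preimage /C /= /P !inE /= in_imfset //=.
  rewrite -[in LHS](untauK (FG _ gF)) /= add0r.
  by have [->|->] := Z2P (x (untau g)).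
set N := cover_number _ _.
have le_N : (2 ^ #|` F'|)%:R <= N.
  apply: lb_le_inf.
    by have [V VP] := ex; exists #|` V|%:R; exists V.
  by move=> _ [V [VJ Vc] <-]; rewrite ler_nat; exact: lower.
have : ln ((2 ^ #|` F'|)%:R : R) <= ln N.
  have pos : 0 < (2 ^ #|` F'|)%:R :> R by rewrite ltr0n expn_gt0.
  by rewrite ler_ln // posrE // (lt_le_trans pos).
rewrite natrX lnXn // => lnN.
apply: le_trans (_ : 2 * (ln 2 *+ #|` F'|) <= _); last by rewrite ler_pM2l.
rewrite -[ln 2 *+ _]mulr_natl mulrA -natrM ler_pM2r ?ln_gt0 ?ltr1n //.
by rewrite ler_nat.
Qed.

(** The bound [ln 2 / 2] holds along every sequence of nonempty finite subsets of
    the group. *)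
Lemma positive_entropy (R : realType) F : folner_sequence R Gam F ->
  (0 < topological_entropy R (@aut_fun config) F)%E.
Proof.
move=> [F0 FG _].
apply: (@lt_le_trans _ _ ((ln 2 / 2 : R)%:E)).
  by rewrite lte_fin divr_gt0 // ln_gt0 // ltr1n.
apply: le_trans (ereal_sup_ubound (ex_intro2 _ _ _ coord_cover_open erefl)).
apply: le_ereal_inf_tmp => _ [A [N _ NA] <-].
apply: le_trans (ereal_sup_ubound (ex_intro2 _ _ N (NA _ (leqnn N)) erefl)).
rewrite lee_fin ler_pdivlMr ?ltr0n ?cardfs_gt0 // mulrAC ler_pdivrMr //.
rewrite mulrC [leRHS]mulrC.
exact: ln_cover_number_ge.
Qed.

Theorem theorem1p2 (R : realType) :
  exists (X : topologicalZmodType) (d : X -> X -> R) (Gam : set (Aut X)),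
    [/\ [/\ compact [set: X], totally_disconnected [set: X]
          & compatible_metric d],
        [/\ group_closed (mem Gam), countable Gam & amenable R Gam],
        [/\ expansive d (@aut_fun X) Gam,
            (forall F, folner_sequence R Gam F ->
               (0 < topological_entropy R (@aut_fun X) F)%E)
          & forall x y : X, asymptotic_pair d (@aut_fun X) Gam x y -> x = y],
        {in Gam &, forall g h, (g * h = h * g)%g}
      & isomorphic_to_direct_sum_Z2 Gam].
Proof.
exists config, dist, Gam; split.
- split; [exact: compact_config|exact: totally_disconnected_config|].
  exact: compatible_dist.
- split; [exact: group_closed_Gam|exact: countable_Gam|exact: amenable_Gam].
- split; [exact: expansive_Gam|exact: positive_entropy|exact: asymptotic_Gam].
- exact: commute_Gam.
- exact: isomorphic_Gam.
Qed.
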